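(* Let $\{S^t\}_{t\ge0}$ be a positive $C_0$ semigroup on $X$ with infinitesimal generator $-G$. Suppose that there exists a number $\gamma>0$ such that $\gamma g\le Gg$ for all $g\in\mathcal D_+(G)$. Then: (a) For each $g\in X_+$, $0\le S^tg\le\exp(-\gamma t)g$ for all $t\ge0$. (b) For each $g\in X_+$ there exists an increasing sequence $\{g_n\}\subset\mathcal D_+(G^\infty)$ such that $g_n\nearrow g$ as $n\to\infty$. (c) Let $p$ be a positive integer. If $\{g_n\}\subset\mathcal D_+(G^p)$ is increasing and $\{G^pg_n\}$ is norm bounded, then there exists $g\in\mathcal D_+(G^p)$ such that $G^kg_n\nearrow G^kg$ as $n\to\infty$ for all $k=0,1,\dots,p$. (d) The sets $\mathcal D_+(G^k)$, $k=1,2,\dots$, and $\mathcal D_+(G^\infty)$ are p-saturated.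
   Context: $X$ is a separable real ordered Banach space with order $\le$ and norm $\|\cdot\|$; its positive cone $X_+=\{g\in X:0\le g\}$ is closed and generating ($X=X_+-X_+$), and the norm is additive on $X_+$: $\|g+h\|=\|g\|+\|h\|$ for $g,h\in X_+$ ($X$ need not be a lattice). A positive $C_0$ semigroup on $X$ is a $C_0$ semigroup leaving $X_+$ invariant. Powers: $G^0=I$, $\mathcal D(G^0)=X$, $\mathcal D(G^k)=\{g\in\mathcal D(G^{k-1}):G^{k-1}g\in\mathcal D(G)\}$, $G^kg=G(G^{k-1}g)$; $\mathcal D_+(G^k)=\mathcal D(G^k)\cap X_+$ and $\mathcal D_+(G^\infty)=\bigcap_{k\ge1}\mathcal D_+(G^k)$. The notation $g_n\nearrow g$ means that the sequence $\{g_n\}$ is increasing for $\le$ and converges to $g$ in norm. A nonempty set $\mathcal M\subset X$ is p-saturated if $h\in\mathcal M$, $g\in X_+$ and $g\le h$ imply $g\in\mathcal M$. *)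

(* Defs.v *)
From HB Require Import structures.
From mathcomp Require Import all_boot all_order all_algebra.
From mathcomp Require Import all_classical all_reals all_analysis.

Set Implicit Arguments.
Unset Strict Implicit.
Unset Printing Implicit Defensive.

Import Order.TTheory GRing.Theory Num.Theory.
Import numFieldNormedType.Exports.

Local Open Scope classical_set_scope.
Local Open Scope ring_scope.

(* The order is a plain relation rather than a [porderType] structure: the
   structure [numDomainType] already inherits from both orders and norms, and
   the hierarchy admits no new structure inheriting from both.  Only the axioms of
   an ordered vector space are imposed; nothing relates order and norm. *)
HB.mixin Record isOrderedBanach (R : realType) X
    of CompleteNormedModule R X := {
  lev : X -> X -> Prop ;
  lev_refl : forall x, lev x x ;
  lev_anti : forall x y, lev x y -> lev y x -> x = y ;
  lev_trans : forall y x z, lev x y -> lev y z -> lev x z ;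
  levD2r : forall z x y, lev x y -> lev (x + z) (y + z) ;
  levZ_ge0 : forall (a : R) x, 0 <= a -> lev 0 x -> lev 0 (a *: x)
}.

#[short(type="orderedBanachType")]
HB.structure Definition OrderedBanach (R : realType) :=
  { X of CompleteNormedModule R X & isOrderedBanach R X }.

Notation "x '<=v' y" := (lev x y) (at level 70, y at next level) : ring_scope.

Definition separable (T : topologicalType) : Prop :=
  exists2 D : set T, countable D & dense D.

Section OrderedBanachDefs.
Context {R : realType}.
Implicit Type X : orderedBanachType R.

Definition pos_cone X : set X := [set g | 0 <=v g].

Definition generating_cone X : Prop :=
  forall g : X, exists u v : X, [/\ pos_cone u, pos_cone v & g = u - v].

Definition norm_additive_on_cone X : Prop :=
  forall g h : X, pos_cone g -> pos_cone h -> `|g + h| = `|g| + `|h|.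

Definition increasing X (u : nat -> X) : Prop :=
  {homo u : n m / (n <= m)%N >-> n <=v m}.

Definition increasing_to X (u : nat -> X) (g : X) : Prop :=
  increasing u /\ u @ \oo --> g.

Definition p_saturated X (M : set X) : Prop :=
  M !=set0 /\ forall g h : X, M h -> pos_cone g -> g <=v h -> M g.

End OrderedBanachDefs.

(* A partially defined operator; the values of [pfun] outside [pdom] are
   irrelevant. *)
Record partial_op (X : Type) := PartialOp {
  pdom : set X ;
  papp :> X -> X
}.

Definition partial_id (X : Type) : partial_op X := PartialOp setT id.

Definition partial_comp (X : Type) (A B : partial_op X) : partial_op X :=
  PartialOp [set g | pdom B g /\ pdom A (B g)] (fun g => A (B g)).

Definition partial_opp (X : zmodType) (A : partial_op X) : partial_op X :=
  PartialOp (pdom A) (fun g => - A g).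

Fixpoint partial_exp (X : Type) (A : partial_op X) (k : nat) : partial_op X :=
  if k is k'.+1 then partial_comp A (partial_exp A k') else partial_id X.

Section Semigroups.
Context {R : realType}.

(* Families are indexed by R, but only the values at t >= 0 matter. *)
Record C0_semigroup (X : completeNormedModType R) (S : R -> X -> X) : Prop := {
  C0_linear : forall t, 0 <= t -> linear (S t) ;
  C0_bounded : forall t, 0 <= t -> continuous (S t) ;
  C0_zero : forall g, S 0 g = g ;
  C0_add : forall s t g, 0 <= s -> 0 <= t -> S (s + t) g = S s (S t g) ;
  C0_strong : forall g, S t g @[t --> 0^'+] --> g
}.

Definition infinitesimal_generator (X : completeNormedModType R)
    (S : R -> X -> X) (A : partial_op X) : Prop :=
  (forall g, pdom A g <-> cvg (t^-1 *: (S t g - g) @[t --> (0 : R)^'+])) /\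
  (forall g, pdom A g -> t^-1 *: (S t g - g) @[t --> (0 : R)^'+] --> A g).

Definition positive_semigroup (X : orderedBanachType R) (S : R -> X -> X)
    : Prop :=
  forall t g, 0 <= t -> pos_cone g -> pos_cone (S t g).

Definition pdom_plus (X : orderedBanachType R) (A : partial_op X) : set X :=
  pdom A `&` @pos_cone R X.

Definition pdom_plus_infty (X : orderedBanachType R) (A : partial_op X)
    : set X :=
  \bigcap_(k in [set k | (1 <= k)%N]) pdom_plus (partial_exp A k).

End Semigroups.

(* Main.v *)
Require Import Defs.
From HB Require Import structures.
From mathcomp Require Import all_boot all_order all_algebra.
From mathcomp Require Import all_classical all_reals all_analysis.
From mathcomp Require Import ring.

(** Write [I_t g] for the integral of [S s g] over [0 <= s <= t].  It is built as
    a limit of Riemann sums with dyadic meshes, using only completeness, strong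
    continuity at 0 and the uniform bound on [S] over bounded times that the
    principle of uniform boundedness provides.  Everything about the generator
    follows from the cocycle identity [I_(s+t) = I_s + S s I_t] and from
    [I_h g / h -> g]: the element [I_t g] lies in the domain of [G] with
    [- G (I_t g) = S t g - g], conversely [S t g - g = - I_t (G g)] for [g] in the
    domain, and [G] is closed.

    (a) The rescaled semigroup [T t = exp (gamma t) S t] has generator
    [gamma - G], which is negative on the positive domain of [G].  For [g] there,
    [g - T t g] is the integral of the positive orbit of [G g - gamma g], so
    [T t g <= g].  Means [I_h g / h] of a positive [g] are positive, belong to the
    domain and approximate [g], hence the inequality extends to the whole closed
    cone ([positive_decay]).

    (b) By (a) positive orbits decrease, so the mean [A_n g] of the orbit over
    [[0, 2 ^- n]] satisfies [S (2 ^- n) g <= A_n g <= g].  The products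
    [A_n A_(n+1) ... A_(n+j-1) g] decrease in [j] and are positive.  As the norm is
    additive on the cone, monotone bounded sequences of positive elements
    converge; let [g_n] be the limit.  Then [g_n = A_n g_(n+1)], which shows that
    [g_n] increases with [n], and that it lies in the domain of all powers of
    [G], since each mean commutes with [G] and gains one power.  Finally
    [S (2 ^- n + 2 ^- n) g <= g_n <= g] forces [g_n -> g] ([smoothing_to]).

    (c) On the positive domain [G >= gamma], so the powers [G^k g_n] with [k <= p]
    are positive, increasing, and bounded in norm by a multiple of [|G^p g_n|].
    They converge, and closedness of [G] identifies the limits
    ([power_monotone_convergence]).

    (d) If [0 <= g <= h] with [h] in the domain of [G^p], the sequence of (b)
    satisfies [0 <= G^p g_n <= G^p h]; then (c) applies ([power_saturated]). *)

Set Implicit Arguments.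
Unset Strict Implicit.
Unset Printing Implicit Defensive.

Import Order.TTheory GRing.Theory Num.Theory.
Import numFieldNormedType.Exports.

Local Open Scope classical_set_scope.
Local Open Scope ring_scope.

(** * Limits in normed spaces *)
Lemma cvg_at_right0P (R : realType) (X : normedModType R) (f : R -> X) (l : X) :
  f t @[t --> (0 : R)^'+] --> l <->
  forall e : R, 0 < e ->
    exists2 d : R, 0 < d & forall t : R, 0 < t < d -> `|f t - l| <= e.
Proof.
split=> [/cvgrPdist_le fl e e0|H].
  have [d /= d0 fd] := fl e e0; exists d => // t /andP[t0 td].
  by rewrite distrC; apply: fd => //=; rewrite sub0r normrN gtr0_norm.
apply/cvgrPdist_le => e e0; have [d d0 fd] := H e e0.
exists d => //= t /=; rewrite sub0r normrN => td t0.
by rewrite distrC; apply: fd; rewrite t0 -(gtr0_norm t0).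
Qed.

Lemma cvg_seq_tailP (R : realType) (X : completeNormedModType R)
    (u : nat -> X) :
  (forall e : R, 0 < e ->
    exists n, forall m, (n <= m)%N -> `|u m - u n| <= e) ->
  cvg (u n @[n --> \oo]).
Proof.
move=> H; apply/cauchy_cvgP; apply: cauchy_exP => e e0.
have [n un] := H (e / 2) (divr_gt0 e0 (ltr0Sn R 1)).
exists (u n); exists n => // m /= nm; rewrite -ball_normE /= distrC.
by rewrite (le_lt_trans (un m nm))// ltr_pdivrMr// ltr_pMr// ltr1n.
Qed.

Lemma norm_cvg_le (R : realType) (X : normedModType R) (u : nat -> X) (l : X)
    (c : R) :
  u n @[n --> \oo] --> l -> (forall n, `|u n| <= c) -> `|l| <= c.
Proof.
move=> ul uc; have nul : `|u n| @[n --> \oo] --> `|l| by exact: cvg_norm.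
by rewrite -(cvg_lim _ nul)//; apply: limr_le; [apply: cvgP nul|exact: nearW].
Qed.

Lemma exp2V_small (R : realType) (c : R) : 0 < c ->
  exists n, forall m, (n <= m)%N -> 2 ^- m <= c.
Proof.
move=> c0; exists (Num.truncn c^-1) => m nm.
rewrite invf_ple ?posrE ?exprn_gt0//.
rewrite (le_trans (ltW (truncnS_gt _)))// -natrX ler_nat.
by rewrite (leq_ltn_trans nm)// ltn_expl.
Qed.

(** * Uniform bounds and commutation for a strongly continuous semigroup *)
Section C0Bounds.
Variables (R : realType) (X : completeNormedModType R) (S : R -> X -> X).
Hypothesis HS : C0_semigroup S.

Let pack (f : X -> X) (lf : linear f) : {linear X -> X} :=
  HB.pack f (GRing.isLinear.Build _ _ _ _ _ lf).

Lemma C0B t x y : 0 <= t -> S t (x - y) = S t x - S t y.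
Proof. by move=> /(C0_linear HS) lS; exact: (linearB (pack lS)). Qed.

Lemma C0Z t a x : 0 <= t -> S t (a *: x) = a *: S t x.
Proof. by move=> /(C0_linear HS) lS; exact: (linearZ_LR (pack lS)). Qed.

Lemma C0_sum t n (f : 'I_n -> X) : 0 <= t ->
  S t (\sum_(i < n) f i) = \sum_(i < n) S t (f i).
Proof. by move=> /(C0_linear HS) lS; exact: (linear_sum (pack lS)). Qed.

Lemma C0_near0 g (e : R) : 0 < e ->
  exists2 d : R, 0 < d & forall t : R, 0 <= t <= d -> `|S t g - g| <= e.
Proof.
move=> e0; have /cvg_at_right0P/(_ e e0)[d d0 Sd] := C0_strong HS (g := g).
exists (d / 2); first by rewrite divr_gt0.
move=> t /andP[]; rewrite le_eqVlt => /predU1P[<- _|t0 td].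
  by rewrite (C0_zero HS) subrr normr0 ltW.
apply: Sd; rewrite t0 (le_lt_trans td)//.
by rewrite ltr_pdivrMr// ltr_pMr// ltr1n.
Qed.

(** Otherwise there are times [tau n <= 1 / (n + 1)] at which the operator norm
    exceeds [n], although strong continuity at 0 keeps [S (tau n) x] bounded
    for every [x]: this contradicts the principle of uniform boundedness. *)
Lemma C0_bounded_near0 :
  exists2 d : R, 0 < d & exists2 M : R, 0 <= M &
    forall (t : R) (g : X), 0 <= t <= d -> `|S t g| <= M * `|g|.
Proof.
apply: contrapT => nobound.
have /choice[tau tauP] : forall n : nat, exists t : R,
    0 <= t <= n.+1%:R^-1 /\ exists g, n%:R * `|g| < `|S t g|.
  move=> n; apply: contrapT => not_t; apply: nobound.
  exists n.+1%:R^-1; first by rewrite invr_gt0.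
  exists n%:R => // t g tn; rewrite leNgt; apply/negP => Stg.
  by apply: not_t; exists t; split => //; exists g.
have tau_ge0 n : 0 <= tau n by have [/andP[]] := tauP n.
have [|x|M MF] :=
    @Banach_Steinhauss R X X [set f | exists n, f = S (tau n)] _ _ 1.
- move=> _ [n ->]; split; last exact: (C0_linear HS).
  apply/(bounded_funP (pack (C0_linear HS (tau_ge0 n)))).
  exact/linear_bounded_continuous/(C0_bounded HS (tau_ge0 n)).
- have [d d0 Sd] := C0_near0 x ltr01.
  have [N tauN] : exists N, forall n, (N <= n)%N -> tau n <= d.
    exists (Num.truncn d^-1) => n Nn; have [/andP[_ tn] _] := tauP n.
    rewrite (le_trans tn)// invf_ple ?posrE// (le_trans (ltW (truncnS_gt _)))//.
    by rewrite ler_nat ltnS.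
  (* The sum dominates the first N terms; later times lie in the range where
     S moves x by at most 1. *)
  exists (\sum_(i < N) `|S (tau i) x| + (1 + `|x|)) => _ [n ->].
  have [nN|Nn] := ltnP n N.
    rewrite (bigD1 (Ordinal nN))//= -addrA lerDl addr_ge0 ?sumr_ge0//.
  rewrite ler_wpDl ?sumr_ge0//.
  rewrite -[S _ x](subrK x) (le_trans (ler_normD _ _))// lerD2r Sd//.
  by rewrite tau_ge0 tauN.
have [_ [g]] := tauP (Num.truncn M).+1.
have [->|g0] := eqVneq g 0.
  have := C0B 0 0 (tau_ge0 (Num.truncn M).+1).
  by rewrite !subrr => ->; rewrite normr0 mulr0 ltxx.
have ng0 : 0 < `|g| by rewrite normr_gt0.
apply/negP; rewrite -leNgt -ler_pdivrMr//.
rewrite (le_trans _ (ltW (truncnS_gt M)))//.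
have -> : `|S (tau (Num.truncn M).+1) g| / `|g|
    = `|S (tau (Num.truncn M).+1) (`|g|^-1 *: g)|.
  by rewrite C0Z// normrZ normfV normr_id mulrC.
apply: MF; first by exists (Num.truncn M).+1.
by rewrite normrZ normfV normr_id mulVf ?gt_eqF.
Qed.

(** The bound near 0 propagates through the semigroup law: each further step of
    length [d] multiplies it by [M]. *)
Lemma C0_bounded_on T :
  exists2 M : R, 0 <= M &
    forall (t : R) (g : X), 0 <= t <= T -> `|S t g| <= M * `|g|.
Proof.
have [d d0 [M M0 SM]] := C0_bounded_near0.
have step n : exists2 K : R, 0 <= K &
    forall (t : R) (g : X), 0 <= t <= n.+1%:R * d -> `|S t g| <= K * `|g|.
  elim: n => [|n [K K0 SK]].
    by exists M => // t g; rewrite mul1r; exact: SM.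
  exists (M * K + M); first by rewrite addr_ge0// mulr_ge0.
  move=> t g /andP[t0 tn]; rewrite mulrDl; have [td|dt] := leP t d.
    by rewrite ler_wpDl ?mulr_ge0// SM// t0.
  rewrite ler_wpDr ?mulr_ge0// -(subrK d t) addrC.
  rewrite (C0_add HS) ?(ltW d0)//; last first.
    by rewrite subr_ge0 ltW.
  rewrite (le_trans (SM _ _ _)) ?lexx ?(ltW d0)// -mulrA ler_wpM2l// SK//.
  by rewrite subr_ge0 (ltW dt)/= lerBlDr -[X in _ + X]mul1r -mulrDl natr1.
have [K K0 SK] := step (Num.truncn (T / d)).
exists K => // t g /andP[t0 tT]; apply: SK; rewrite t0 (le_trans tT)//.
by rewrite -ler_pdivrMr// ltW// truncnS_gt.
Qed.

(** Strong continuity is only assumed from the right at 0; at [s] it gives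
    continuity from the left because [S s - S t = S t (S (s - t) - 1)] and
    [S t] is bounded uniformly in [t <= s]. *)
Lemma C0_left_approx (s e : R) g : 0 <= s -> 0 < e ->
  exists2 d : R, 0 < d & forall t : R, 0 <= t <= s -> s - t <= d ->
    `|S s g - S t g| <= e.
Proof.
move=> s0 e0; have [M M0 SM] := C0_bounded_on s.
have M1 : 0 < M + 1 by rewrite ltr_wpDl.
have [d d0 Sd] := C0_near0 g (divr_gt0 e0 M1).
exists d => // t /andP[t0 ts] std.
have -> : S s g = S t (S (s - t) g).
  by rewrite -(C0_add HS) ?subr_ge0// addrC subrK.
rewrite -C0B//.
rewrite (le_trans (SM _ _ _)) ?t0// (@le_trans _ _ ((M + 1) * (e / (M + 1))))//.
  by rewrite ler_pM// ?lerDl ?ler01// Sd// subr_ge0 ts.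
by rewrite mulrCA divff ?mulr1// gt_eqF.
Qed.

Lemma C0_left_cvg (s : R) (a : nat -> R) (u : nat -> X) (y : X) : 0 <= s ->
  (forall n, 0 <= a n <= s) -> a n @[n --> \oo] --> s ->
  u n @[n --> \oo] --> y -> S (a n) (u n) @[n --> \oo] --> S s y.
Proof.
move=> s0 a0s /cvgrPdist_le as_ uy; have [M M0 SM] := C0_bounded_on s.
have a0 n : 0 <= a n by have /andP[] := a0s n.
apply/cvgrPdist_le => e e0; have e2 : 0 < e / 2 by rewrite divr_gt0.
have M1 : 0 < M + 1 by rewrite ltr_wpDl.
have [d d0 Sd] := C0_left_approx y s0 e2.
move/cvgrPdist_le : uy => /(_ _ (divr_gt0 e2 M1)) uy.
near=> n.
rewrite -(subrK (S (a n) y) (S s y)) -addrA -C0B//.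
rewrite (le_trans (ler_normD _ _))// [leRHS](splitr e) lerD//.
  rewrite Sd// (le_trans (ler_norm _))//; near: n; exact: as_.
rewrite (le_trans (SM _ _ (a0s n)))//.
rewrite (@le_trans _ _ ((M + 1) * (e / 2 / (M + 1))))//.
  rewrite ler_pM// ?lerDl ?ler01//; near: n; exact: uy.
by rewrite mulrCA divff ?mulr1// gt_eqF.
Unshelve. all: by end_near. Qed.

Lemma C0_commute s t g : 0 <= s -> 0 <= t -> S s (S t g) = S t (S s g).
Proof. by move=> s0 t0; rewrite -!(C0_add HS)// addrC. Qed.

End C0Bounds.

(** * Dyadic subdivisions of an interval *)
Section DyadicSteps.
Variable R : realType.

Definition dyadic_steps (n : nat) (t : R) : nat := Num.truncn (t * 2 ^+ n).

Lemma exp2V_ge0 n : 0 <= 2 ^- n :> R. Proof. by rewrite invr_ge0 exprn_ge0. Qed.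

Let exp2_gt0 n : 0 < 2 ^+ n :> R. Proof. by rewrite exprn_gt0. Qed.

Lemma dyadic_steps_le n t : 0 <= t -> (dyadic_steps n t)%:R * 2 ^- n <= t.
Proof.
move=> t0; rewrite ler_pdivrMr//.
by rewrite truncn_le mulr_ge0// ltW.
Qed.

Lemma dyadic_steps_gt n t : t <= (dyadic_steps n t)%:R * 2 ^- n + 2 ^- n.
Proof.
by rewrite -[X in _ + X]mul1r -mulrDl ler_pdivlMr// natr1 ltW// truncnS_gt.
Qed.

Lemma dyadic_steps_cvg t : 0 <= t ->
  (dyadic_steps n t)%:R * 2 ^- n @[n --> \oo] --> t.
Proof.
move=> t0; apply/cvgrPdist_le => e e0; have [n nP] := exp2V_small e0.
exists n => // m /= nm; rewrite ger0_norm ?subr_ge0 ?dyadic_steps_le//.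
by rewrite lerBlDl (le_trans (dyadic_steps_gt m t))// lerD2l nP.
Qed.

Lemma dyadic_steps_refine n k t : 0 <= t -> exists2 r, (r < 2 ^ k)%N &
  dyadic_steps (n + k) t = (dyadic_steps n t * 2 ^ k + r)%N.
Proof.
move=> t0; set N := dyadic_steps n t; set N' := dyadic_steps _ t.
have t1 : 0 <= t * 2 ^+ n by rewrite mulr_ge0// ltW.
have t2 : 0 <= t * 2 ^+ (n + k) by rewrite mulr_ge0// ltW.
have NN' : (N * 2 ^ k <= N')%N.
  rewrite truncn_ge_nat// natrM natrX exprD mulrA ler_wpM2r ?exprn_ge0//.
  by rewrite truncn_le.
exists (N' - N * 2 ^ k)%N; last by rewrite subnKC.
rewrite ltn_subLR// addnC -mulSn truncn_lt_nat// exprD mulrA natrM natrX.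
by rewrite ltr_pM2r// truncnS_gt.
Qed.

Lemma dyadic_stepsD n s t : 0 <= s -> 0 <= t -> exists2 b, (b <= 1)%N &
  dyadic_steps n (s + t) = (dyadic_steps n s + dyadic_steps n t + b)%N.
Proof.
move=> s0 t0; set A := dyadic_steps n s; set B := dyadic_steps n t.
have st x : 0 <= x -> 0 <= x * 2 ^+ n by move=> x0; rewrite mulr_ge0// ltW.
exists (dyadic_steps n (s + t) - (A + B))%N; last first.
  rewrite subnKC// truncn_ge_nat ?st ?addr_ge0// natrD mulrDl.
  by rewrite lerD// truncn_le st.
rewrite leq_subLR -ltnS truncn_lt_nat ?st ?addr_ge0// mulrDl.
rewrite addn1 -addnS -addSn natrD.
by rewrite ltrD// truncnS_gt.
Qed.

End DyadicSteps.

(** * Integrals along orbits *)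
Section C0Integral.
Variables (R : realType) (X : completeNormedModType R) (S : R -> X -> X).
Hypothesis HS : C0_semigroup S.

Definition mesh_sum (h : R) (N : nat) (g : X) : X :=
  h *: \sum_(i < N) S (i%:R * h) g.

Lemma mesh_sumD h M N g : 0 <= h ->
  mesh_sum h (M + N) g = mesh_sum h M g + S (M%:R * h) (mesh_sum h N g).
Proof.
move=> h0; have Mh0 : 0 <= M%:R * h by rewrite mulr_ge0.
rewrite /mesh_sum (C0Z HS)// -scalerDr big_split_ord/= (C0_sum HS)//.
congr (_ *: (_ + _)); apply: eq_bigr => i _.
by rewrite natrD mulrDl (C0_add HS)// mulr_ge0.
Qed.

Lemma mesh_sum_refine h K N g : 0 <= h ->
  mesh_sum h (N * K) g = \sum_(j < N) S (j%:R * (K%:R * h)) (mesh_sum h K g).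
Proof.
move=> h0; elim: N => [|N IH]; first by rewrite /mesh_sum !big_ord0 scaler0.
by rewrite mulSnr mesh_sumD// IH big_ord_recr/= natrM mulrA.
Qed.

(** With [y = g] this compares a Riemann sum with a single term of the coarser
    subdivision, with [y = 0] it bounds the sum itself. *)
Lemma mesh_sum_dist h N g y e : 0 <= h ->
  (forall t, 0 <= t <= N%:R * h -> `|S t g - y| <= e) ->
  `|mesh_sum h N g - (N%:R * h) *: y| <= N%:R * h * e.
Proof.
move=> h0 Se; rewrite mulrC -scalerA scaler_nat -[N in y *+ N]card_ord.
rewrite -sumr_const -scalerBr -sumrB normrZ ger0_norm// mulrAC -mulrA.
rewrite ler_wpM2l// (le_trans (ler_norm_sum _ _ _))//.
rewrite (@le_trans _ _ (\sum_(i < N) e))//; last first.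
  by rewrite sumr_const card_ord mulr_natr.
apply: ler_sum => i _; apply: Se; rewrite mulr_ge0//=.
by rewrite ler_wpM2r// ler_nat ltnW.
Qed.

(** The mesh is [2 ^- n] whatever the interval, instead of a fraction of its
    length [t]: the subdivisions for two values of [t] then agree where they
    overlap, so that additivity of the integral in [t] only costs the rounding
    of numbers of steps. *)
Definition riemann (n : nat) (t : R) (g : X) : X :=
  mesh_sum (2 ^- n) (dyadic_steps n t) g.

Definition orbit_int (t : R) (g : X) : X := lim (riemann n t g @[n --> \oo]).

(** Refining the mesh from [H = 2 ^- n] to [2 ^- m] replaces each term
    [S (j H) (H *: g)] by [S (j H)] applied to a Riemann sum over [[0, H]], which
    is close to [H *: g] by strong continuity at 0; less than one step of
    length [H] is left at the end.  The uniform bound [M] on [S] over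
    [[0, t]] controls the total error by [t M e' + H M ^ 2 |g|]. *)
Lemma riemann_is_cvg t g : 0 <= t -> cvg (riemann n t g @[n --> \oo]).
Proof.
move=> t0; have [M M0 SM] := C0_bounded_on HS t.
apply: cvg_seq_tailP => e e0.
have e2 : 0 < e / 2 by rewrite divr_gt0.
pose c1 := t * M + 1; have c10 : 0 < c1 by rewrite ltr_wpDl// mulr_ge0.
pose c2 := M * (M * `|g|) + 1.
have c20 : 0 < c2 by rewrite ltr_wpDl// !mulr_ge0.
have [d d0 Sd] := C0_near0 HS g (divr_gt0 e2 c10).
have [n1 n1P] := exp2V_small d0.
have [n2 n2P] := exp2V_small (divr_gt0 e2 c20).
exists (maxn n1 n2) => m; set n := maxn n1 n2 => nm.
have {n1P}Hd : 2 ^- n <= d by rewrite n1P// leq_maxl.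
have {n2P}He : 2 ^- n <= e / 2 / c2 by rewrite n2P// leq_maxr.
rewrite -(subnKC nm) /riemann; set k := (m - n)%N.
have [r rk Nr] := dyadic_steps_refine n k t0; rewrite Nr.
set N := dyadic_steps n t; set h := 2 ^- (n + k).
have h0 : 0 <= h by exact: exp2V_ge0.
have Kh : (2 ^ k)%:R * h = 2 ^- n.
  by rewrite /h natrX exprD invfM mulrA mulrAC mulfV ?mul1r// gt_eqF.
have NH : N%:R * 2 ^- n <= t by exact: dyadic_steps_le.
have Nh : (N * 2 ^ k)%:R * h <= t by rewrite natrM -mulrA Kh.
have rh : r%:R * h <= 2 ^- n by rewrite -Kh ler_wpM2r// ler_nat ltnW.
rewrite mesh_sumD// mesh_sum_refine// Kh.
have -> : mesh_sum (2 ^- n) N g = \sum_(j < N) S (j%:R * 2 ^- n) (2 ^- n *: g).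
  rewrite /mesh_sum scaler_sumr; apply: eq_bigr => i _.
  by rewrite (C0Z HS)// mulr_ge0.
rewrite addrAC -sumrB [leRHS](splitr e) (le_trans (ler_normD _ _))// lerD//.
- rewrite (le_trans (ler_norm_sum _ _ _))//.
  have jH (j : 'I_N) : 0 <= (j%:R : R) * 2 ^- n <= t.
    by rewrite mulr_ge0//= (le_trans _ NH)// ler_wpM2r// ler_nat ltnW.
  rewrite (@le_trans _ _ (\sum_(j < N) M * (2 ^- n * (e / 2 / c1))))//.
    apply: ler_sum => j _; have /andP[j0 _] := jH j.
    rewrite -(C0B HS)// (le_trans (SM _ _ (jH j)))// ler_wpM2l//.
    rewrite -Kh mesh_sum_dist// => s /andP[s0]; rewrite Kh => sH.
    by rewrite Sd// s0 (le_trans sH).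
  rewrite sumr_const card_ord -[leLHS]mulr_natl.
  have -> : N%:R * (M * (2 ^- n * (e / 2 / c1)))
      = (N%:R * 2 ^- n) * M * (e / 2 / c1) by ring.
  rewrite (@le_trans _ _ (c1 * (e / 2 / c1)))//; last first.
    by rewrite mulrCA divff ?mulr1// gt_eqF.
  have ec0 : 0 <= e / 2 / c1 by rewrite divr_ge0// ltW.
  rewrite ler_wpM2r// (@le_trans _ _ (t * M)) ?ler_wpM2r//.
  by rewrite lerDl.
- rewrite (le_trans (SM _ _ _)) ?Nh ?mulr_ge0//.
  have rht : r%:R * h <= t.
    rewrite (le_trans _ (dyadic_steps_le (n + k) t0))// ler_wpM2r//.
    by rewrite /dyadic_steps in Nr *; rewrite Nr ler_nat leq_addl.
  have : `|mesh_sum h r g - (r%:R * h) *: 0| <= r%:R * h * (M * `|g|).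
    apply: mesh_sum_dist => // s /andP[s0 sr]; rewrite subr0 SM// s0.
    by rewrite (le_trans sr).
  rewrite scaler0 subr0 => mr.
  rewrite (@le_trans _ _ (2 ^- n * c2))//; last first.
    by rewrite -ler_pdivlMr.
  rewrite (@le_trans _ _ (M * (2 ^- n * (M * `|g|))))//.
    by rewrite ler_wpM2l// (le_trans mr)// ler_wpM2r// mulr_ge0.
  by rewrite mulrCA ler_wpM2l// lerDl.
Qed.

Lemma riemann_cvg t g : 0 <= t -> riemann n t g @[n --> \oo] --> orbit_int t g.
Proof. exact: riemann_is_cvg. Qed.

Lemma orbit_int_linear t : 0 <= t -> linear (orbit_int t).
Proof.
move=> t0 a x y; apply: cvg_lim => //.
have -> : (fun n => riemann n t (a *: x + y)) =
    (fun n => a *: riemann n t x + riemann n t y).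
  apply/funext => n; rewrite /riemann /mesh_sum scalerA mulrC -scalerA.
  rewrite -scalerDr.
  congr (_ *: _); rewrite scaler_sumr -big_split/=; apply: eq_bigr => i _.
  by rewrite (C0_linear HS)// mulr_ge0// exp2V_ge0.
by apply: cvgD; [apply: cvgZl_tmp|]; exact: riemann_cvg.
Qed.

Let pack_int t (t0 : 0 <= t) : {linear X -> X} := HB.pack (orbit_int t)
  (GRing.isLinear.Build _ _ _ _ _ (orbit_int_linear t0)).

Lemma orbit_intB t x y : 0 <= t ->
  orbit_int t (x - y) = orbit_int t x - orbit_int t y.
Proof. by move=> t0; exact: (linearB (pack_int t0)). Qed.

Lemma orbit_intZ t a x : 0 <= t -> orbit_int t (a *: x) = a *: orbit_int t x.
Proof. by move=> t0; exact: (linearZ_LR (pack_int t0)). Qed.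

(** Together with [orbit_int_derivative] this commutation is what moves the
    generator inside the integral. *)
Lemma C0_orbit_int s t g : 0 <= s -> 0 <= t ->
  S s (orbit_int t g) = orbit_int t (S s g).
Proof.
move=> s0 t0; apply/esym/cvg_lim => //.
have -> : (fun n => riemann n t (S s g)) = (fun n => S s (riemann n t g)).
  apply/funext => n; rewrite /riemann /mesh_sum (C0Z HS)// (C0_sum HS)//.
  congr (_ *: _); apply: eq_bigr => i _.
  by rewrite (C0_commute HS)// mulr_ge0// exp2V_ge0.
apply: continuous_cvg; [exact: (C0_bounded HS)|exact: riemann_cvg].
Qed.

Lemma orbit_int_dist t g y e : 0 <= t ->
  (forall s, 0 <= s <= t -> `|S s g - y| <= e) ->
  `|orbit_int t g - t *: y| <= t * e.
Proof.
move=> t0 Se.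
have e0 : 0 <= e by rewrite (le_trans _ (Se 0 _)) ?lexx.
apply: (@norm_cvg_le _ _
  (fun n => riemann n t g - ((dyadic_steps n t)%:R * 2 ^- n) *: y)).
  apply: cvgB; first exact: riemann_cvg.
  by apply: cvgZr_tmp; exact: dyadic_steps_cvg.
move=> n; rewrite (@le_trans _ _ ((dyadic_steps n t)%:R * 2 ^- n * e))//.
  apply: mesh_sum_dist => [|s /andP[s0 st]]; first exact: exp2V_ge0.
  by rewrite Se// s0 (le_trans st)// dyadic_steps_le.
by rewrite ler_wpM2r// dyadic_steps_le.
Qed.

Lemma orbit_int_continuous t : 0 <= t -> continuous (orbit_int t).
Proof.
move=> t0; have [M M0 SM] := C0_bounded_on HS t.
apply/(linear_bounded_continuous (pack_int t0))/bounded_funP => r.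
exists (t * (M * r)) => x xr.
have := @orbit_int_dist t x 0 (M * r) t0; rewrite scaler0 subr0; apply.
by move=> s st; rewrite subr0 (le_trans (SM _ _ st))// ler_wpM2l.
Qed.

(** The cocycle identity holds for Riemann sums up to one term, since the number
    of steps in [[0, s + t]] exceeds the sum of the numbers of steps in [[0, s]]
    and [[0, t]] by at most 1; that term has size [O(2 ^- n)]. *)
Lemma orbit_intD s t g : 0 <= s -> 0 <= t ->
  orbit_int (s + t) g = orbit_int s g + S s (orbit_int t g).
Proof.
move=> s0 t0; have st0 : 0 <= s + t by rewrite addr_ge0.
have [M M0 SM] := C0_bounded_on HS (s + t).
pose a n : R := (dyadic_steps n s)%:R * 2 ^- n.
pose b n : R := (dyadic_steps n t)%:R * 2 ^- n.
have a0 n : 0 <= a n by rewrite mulr_ge0// exp2V_ge0.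
have b0 n : 0 <= b n by rewrite mulr_ge0// exp2V_ge0.
have as_ n : a n <= s by exact: dyadic_steps_le.
have bt n : b n <= t by exact: dyadic_steps_le.
have /choice[r rP] n : exists b, (b <= 1)%N /\
    dyadic_steps n (s + t) = (dyadic_steps n s + dyadic_steps n t + b)%N.
  by have [j j1 jE] := dyadic_stepsD n s0 t0; exists j.
have riemannD n : riemann n (s + t) g - riemann n s g =
    S (a n) (riemann n t g) + S (a n + b n) (mesh_sum (2 ^- n) (r n) g).
  have [_ rn] := rP n.
  rewrite /riemann rn mesh_sumD ?exp2V_ge0// mesh_sumD ?exp2V_ge0//.
  rewrite natrD mulrDl.
  by rewrite -[X in X - _]addrA [LHS]addrC addKr.
apply/eqP; rewrite [eqbRHS]addrC -subr_eq; apply/eqP.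
apply: (@cvg_unique _ (@norm_hausdorff _ X)
  ((fun n => riemann n (s + t) g - riemann n s g) @ \oo)).
  by apply: cvgB; exact: riemann_cvg.
rewrite /= (funext riemannD) -[S s _]addr0.
apply: cvgD.
  apply: (C0_left_cvg HS) => //; last exact: riemann_cvg.
  - by move=> n; rewrite a0 as_.
  - exact: dyadic_steps_cvg.
apply/cvgrPdist_le => e e0; have c0 : 0 < M * `|g| + 1.
  by rewrite ltr_wpDl// mulr_ge0.
have [n nP] := exp2V_small (divr_gt0 e0 c0); exists n => // m /= nm.
rewrite sub0r normrN (le_trans (SM _ _ _)) ?addr_ge0 ?lerD//.
have := nP m nm; rewrite ler_pdivlMr// => {}nP.
rewrite (le_trans _ nP)// mulrDr mulr1 ler_wpDr ?exp2V_ge0//.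
have [+ _] := rP m; case: (r m) => [_|[_|//]]; rewrite /mesh_sum ?big_ord0.
  by rewrite scaler0 normr0 mulr0 !mulr_ge0// exp2V_ge0.
rewrite big_ord1 mul0r (C0_zero HS) normrZ ger0_norm ?exp2V_ge0//.
by rewrite mulrCA.
Qed.

Lemma orbit_int_average g : t^-1 *: orbit_int t g @[t --> 0^'+] --> g.
Proof.
apply/cvg_at_right0P => e e0; have [d d0 Sd] := C0_near0 HS g e0.
exists d => // t /andP[t0 td].
have -> : t^-1 *: orbit_int t g - g = t^-1 *: (orbit_int t g - t *: g).
  by rewrite scalerBr scalerA mulVf ?gt_eqF// scale1r.
rewrite normrZ gtr0_norm ?invr_gt0// mulrC ler_pdivrMr// mulrC.
apply: orbit_int_dist; first exact: ltW.
by move=> s /andP[s0 st]; rewrite Sd// s0 (le_trans st)// ltW.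
Qed.

(** The graph of the infinitesimal generator, as a relation: [y] is the right
    derivative at time 0 of the orbit of [g]. *)
Definition orbit_derivative (g y : X) : Prop :=
  t^-1 *: (S t g - g) @[t --> (0 : R)^'+] --> y.

(** The symmetry of the cocycle identity in its two times gives
    [(S h - 1) I_t = (S t - 1) I_h], where [I] is the orbit integral, and
    [I_h g / h] tends to [g].  In particular every orbit integral lies in the
    domain of the generator. *)
Lemma orbit_derivative_int t g : 0 <= t ->
  orbit_derivative (orbit_int t g) (S t g - g).
Proof.
move=> t0; rewrite /orbit_derivative.
have : S t (h^-1 *: orbit_int h g) - h^-1 *: orbit_int h g
    @[h --> (0 : R)^'+] --> S t g - g.
  apply: cvgB; last exact: orbit_int_average.
  apply: continuous_cvg; [exact: (C0_bounded HS)|exact: orbit_int_average].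
apply: cvg_trans; apply: near_eq_cvg; near=> h.
have h0 : 0 < h by near: h; exact: nbhs_right_gt.
rewrite (C0Z HS)// -scalerBr; congr (_ *: _).
have := orbit_intD g t0 (ltW h0); rewrite addrC orbit_intD ?(ltW h0)// => E.
by apply/eqP; rewrite subr_eq addrAC eq_sym subr_eq [eqbLHS]addrC E addrC.
Unshelve. all: by end_near. Qed.

(** The fundamental theorem of calculus along orbits: [I_t] is continuous and
    commutes with [S h], so both sides are the limit of
    [I_t ((S h g - g) / h) = (S h - 1) (I_t g) / h]. *)
Lemma orbit_int_derivative t g y : 0 <= t -> orbit_derivative g y ->
  orbit_int t y = S t g - g.
Proof.
move=> t0 gy.
apply: (@cvg_unique _ (@norm_hausdorff _ X)
  (orbit_int t (h^-1 *: (S h g - g)) @[h --> (0 : R)^'+])).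
  by apply: continuous_cvg; [exact: orbit_int_continuous|exact: gy].
have := orbit_derivative_int t0 (g := g).
apply: cvg_trans; apply: near_eq_cvg; near=> h.
have h0 : 0 < h by near: h; exact: nbhs_right_gt.
by rewrite C0_orbit_int ?(ltW h0)// orbit_intZ// orbit_intB.
Unshelve. all: by end_near. Qed.

(** The identity [I_h y = S h x - x] passes to the limit in [x] and [y], because
    [I_h] and [S h] are continuous; dividing it by [h] recovers the derivative. *)
Lemma orbit_derivative_closed (u v : nat -> X) x y :
  (forall n, orbit_derivative (u n) (v n)) ->
  u n @[n --> \oo] --> x -> v n @[n --> \oo] --> y -> orbit_derivative x y.
Proof.
move=> uv ux vy; have := orbit_int_average (g := y); rewrite /orbit_derivative.
apply: cvg_trans; apply: near_eq_cvg; near=> h.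
have h0 : 0 <= h by apply/ltW; near: h; exact: nbhs_right_gt.
congr (_ *: _).
apply: (@cvg_unique _ (@norm_hausdorff _ X) (orbit_int h (v n) @[n --> \oo])).
  by apply: continuous_cvg => //; exact: orbit_int_continuous.
rewrite (_ : (fun n => _) = fun n => S h (u n) - u n); last first.
  by apply/funext => n; exact: orbit_int_derivative.
by apply: cvgB => //; apply: continuous_cvg => //; exact: (C0_bounded HS).
Unshelve. all: by end_near. Qed.

End C0Integral.

(** * Monotone convergence when the norm is additive on the cone *)
Section OrderedBanachTheory.
Variables (R : realType) (X : orderedBanachType R).
Implicit Types x y z g h : X.

Lemma lev_subr0 x y : (x <=v y) <-> (0 <=v y - x).
Proof.
by split=> [/(levD2r (- x))|/(levD2r x)]; rewrite ?subrr// subrK add0r.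
Qed.

Lemma levD x y z w : x <=v y -> z <=v w -> x + z <=v y + w.
Proof.
move=> xy zw; apply: lev_trans (levD2r z _ _ xy) _.
by rewrite ![y + _]addrC; exact: levD2r.
Qed.

Lemma levN2 x y : x <=v y -> - y <=v - x.
Proof. by move=> /lev_subr0 xy; apply/lev_subr0; rewrite opprK addrC. Qed.

Lemma levZ2 (a : R) x y : 0 <= a -> x <=v y -> a *: x <=v a *: y.
Proof.
move=> a0 /lev_subr0 xy; apply/lev_subr0; rewrite -scalerBr; exact: levZ_ge0.
Qed.

Lemma lev_sum n (f f' : 'I_n -> X) :
  (forall i, f i <=v f' i) -> \sum_(i < n) f i <=v \sum_(i < n) f' i.
Proof.
move=> ff'; elim/big_ind2: _ => // [|x1 x2 y1 y2]; first exact: lev_refl.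
exact: levD.
Qed.

Lemma increasing_step (u : nat -> X) :
  (forall n, u n <=v u n.+1) -> increasing u.
Proof.
move=> uS n m /subnKC <-; elim: (m - n)%N => [|k IH].
  by rewrite addn0; exact: lev_refl.
by rewrite addnS; exact: lev_trans IH (uS _).
Qed.

Hypothesis cone_closed : closed (@pos_cone R X).

Lemma lev_cvg (u v : nat -> X) x y : u n @[n --> \oo] --> x ->
  v n @[n --> \oo] --> y -> (forall n, u n <=v v n) -> x <=v y.
Proof.
move=> ux vy uv; apply/lev_subr0.
apply: (@closed_cvg _ _ \oo _ (fun n => v n - u n) (@pos_cone R X)) => //.
  by apply: nearW => n; move/lev_subr0: (uv n).
exact: cvgB.
Qed.

Lemma lev_lim_le (u : nat -> X) x c : u n @[n --> \oo] --> x ->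
  (forall n, u n <=v c) -> x <=v c.
Proof. by move=> ux; apply: (lev_cvg ux); exact: cvg_cst. Qed.

Lemma lev_lim_ge (u : nat -> X) x c : u n @[n --> \oo] --> x ->
  (forall n, c <=v u n) -> c <=v x.
Proof. by move=> ux; apply: (lev_cvg _ ux); exact: cvg_cst. Qed.

Hypothesis norm_additive : norm_additive_on_cone X.

(** Additivity of the norm on [h = g + (h - g)]; monotone convergence rests on
    this identity. *)
Lemma normB_pos g h : 0 <=v g -> g <=v h -> `|h - g| = `|h| - `|g|.
Proof.
move=> g0 /lev_subr0 gh; apply/eqP; rewrite eq_sym subr_eq -norm_additive//.
by rewrite subrK.
Qed.

Lemma lev_norm g h : 0 <=v g -> g <=v h -> `|g| <= `|h|.
Proof. by move=> g0 gh; rewrite -subr_ge0 -normB_pos. Qed.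

(** The norms increase and are bounded, hence form a Cauchy sequence, and
    [|u m - u n| = |u m| - |u n|]. *)
Lemma increasing_bounded_cvg (u : nat -> X) (c : R) :
  (forall n, 0 <=v u n) -> increasing u -> (forall n, `|u n| <= c) ->
  cvg (u n @[n --> \oo]).
Proof.
move=> u0 iu uc; apply: cvg_seq_tailP => e e0.
have nu : nondecreasing_seq (fun n => `|u n|).
  by move=> n m nm; apply: lev_norm; [exact: u0|exact: iu].
have nub : has_ubound (range (fun n => `|u n|)) by exists c => _ [n _ <-].
have ncv := nondecreasing_is_cvgn nu nub.
have /cvgrPdist_le/(_ e e0)[n _ nP] := ncv.
exists n => m nm; rewrite normB_pos//; last exact: iu.
have := nP n (leqnn n); have := nondecreasing_cvgn_le nu ncv m => /= um.
rewrite ger0_norm ?subr_ge0 ?nondecreasing_cvgn_le//.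
by apply: le_trans; rewrite lerD2r.
Qed.

(** Apply the increasing case to [u 0 - u n], which lies between 0 and [u 0]. *)
Lemma decreasing_pos_cvg (u : nat -> X) : (forall n, 0 <=v u n) ->
  (forall n, u n.+1 <=v u n) -> cvg (u n @[n --> \oo]).
Proof.
move=> u0 uS; pose v n := u 0 - u n.
have iv : increasing v.
  apply: increasing_step => n; rewrite /v ![u 0 - _]addrC.
  exact/levD2r/levN2.
have v0 n : 0 <=v v n by have := iv 0 n (leq0n n); rewrite /v subrr.
have cv : cvg (v n @[n --> \oo]).
  apply: (@increasing_bounded_cvg v `|u 0|) => // n; apply: lev_norm => //.
  by apply/lev_subr0; rewrite /v opprB addrC subrK.
have -> : u = (fun n => u 0 - v n).
  by apply/funext => n; rewrite /v opprB addrC subrK.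
exact: is_cvgB (is_cvg_cst _) cv.
Qed.

End OrderedBanachTheory.

(** * Order estimates for positive semigroups *)
Section PositiveC0.
Variables (R : realType) (X : orderedBanachType R) (S : R -> X -> X).
Hypothesis cone_closed : closed (@pos_cone R X).
Hypothesis HS : C0_semigroup S.

Lemma mesh_sum_lev h N x g : 0 <= h ->
  (forall t, 0 <= t <= N%:R * h -> x <=v S t g) ->
  (N%:R * h) *: x <=v mesh_sum S h N g.
Proof.
move=> h0 xS; rewrite mulrC -scalerA scaler_nat -[N in x *+ N]card_ord.
rewrite -sumr_const; apply: levZ2 => //; apply: lev_sum => i; apply: xS.
by rewrite mulr_ge0//= ler_wpM2r// ler_nat ltnW.
Qed.

Lemma lev_orbit_int t x g : 0 <= t ->
  (forall s, 0 <= s <= t -> x <=v S s g) -> t *: x <=v orbit_int S t g.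
Proof.
move=> t0 xS.
apply: (lev_cvg cone_closed
  (u := fun n => ((dyadic_steps n t)%:R * 2 ^- n) *: x)
  (v := fun n => riemann S n t g)).
- by apply: cvgZr_tmp; exact: dyadic_steps_cvg.
- exact: riemann_cvg.
- move=> n; apply: mesh_sum_lev => [|s /andP[s0 st]]; first exact: exp2V_ge0.
  by apply: xS; rewrite s0 (le_trans st)// dyadic_steps_le.
Qed.

Lemma orbit_int_lev t x g : 0 <= t ->
  (forall s, 0 <= s <= t -> S s g <=v x) -> orbit_int S t g <=v t *: x.
Proof.
move=> t0 Sx; rewrite -[X in X <=v _]opprK -[X in _ <=v X]opprK; apply: levN2.
rewrite -scalerN -(scaleN1r (orbit_int _ _ _)) -(orbit_intZ HS)// scaleN1r.
apply: lev_orbit_int => // s /[dup] st /andP[s0 _].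
by rewrite -(scaleN1r g) (C0Z HS)// scaleN1r; apply: levN2; exact: Sx.
Qed.

Hypothesis Spos : positive_semigroup S.

Lemma C0_lev t x y : 0 <= t -> x <=v y -> S t x <=v S t y.
Proof.
move=> t0 /lev_subr0 xy; apply/lev_subr0; rewrite -(C0B HS)//; exact: Spos.
Qed.

Lemma orbit_int_pos t g : 0 <= t -> 0 <=v g -> 0 <=v orbit_int S t g.
Proof.
move=> t0 g0; rewrite -(scaler0 _ t); apply: lev_orbit_int => // s /andP[s0 _].
exact: Spos.
Qed.

(** Indeed [g - S t g] is the orbit integral of [- y], which is positive. *)
Lemma orbit_derivative_le0 g y t : 0 <= t -> orbit_derivative S g y ->
  y <=v 0 -> S t g <=v g.
Proof.
move=> t0 gy y0; apply/lev_subr0.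
rewrite -opprB -(orbit_int_derivative HS t0 gy) -scaleN1r -(orbit_intZ HS)//.
rewrite scaleN1r; apply: orbit_int_pos => //.
by rewrite -[0]oppr0; exact: levN2.
Qed.

End PositiveC0.

(** * Exponential rescaling of a semigroup *)
Section Rescaling.
Variables (R : realType) (X : completeNormedModType R) (S : R -> X -> X).
Hypothesis HS : C0_semigroup S.
Variable gamma : R.

(** Multiplying by the exponential shifts the generator by [gamma], which turns
    decay at rate [gamma] into monotonicity. *)
Definition rescaled (t : R) (g : X) : X := expR (gamma * t) *: S t g.

Let expR_scale_cvg0 : expR (gamma * t) @[t --> (0 : R)^'+] --> (1 : R).
Proof.
apply: cvg_at_right_filter.
have : expR (gamma * t) @[t --> (0 : R)] --> expR (gamma * 0).
  by apply: continuous_cvg; [exact: continuous_expR|exact: mulrl_continuous].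
by rewrite mulr0 expR0.
Qed.

Lemma rescaled_C0 : C0_semigroup rescaled.
Proof.
split.
- move=> t t0 a x y; rewrite /rescaled (C0_linear HS)// scalerDr !scalerA.
  by rewrite mulrC.
- move=> t t0 x; apply: cvgZl_tmp; exact: (C0_bounded HS).
- by move=> g; rewrite /rescaled mulr0 expR0 scale1r (C0_zero HS).
- move=> s t g s0 t0; rewrite /rescaled (C0Z HS)// (C0_add HS)// scalerA.
  by rewrite mulrDr expRD.
- move=> g; rewrite -[X in _ --> X]scale1r.
  by apply: cvgZ; [exact: expR_scale_cvg0|exact: (C0_strong HS)].
Qed.

Lemma rescaled_derivative g y : orbit_derivative S g y ->
  orbit_derivative rescaled g (y + gamma *: g).
Proof.
move=> gy; rewrite /orbit_derivative.
have : expR (gamma * t) *: (t^-1 *: (S t g - g)) +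
    (t^-1 * (expR (gamma * t) - 1)) *: g @[t --> (0 : R)^'+] -->
    y + gamma *: g.
  apply: cvgD.
    rewrite -[X in _ --> X]scale1r; apply: cvgZ => //; exact: expR_scale_cvg0.
  apply: cvgZr_tmp.
  have D : is_derive (0 : R) 1 (expR \o *%R gamma) (expR (gamma * 0) * gamma).
    apply: is_derive1_comp; rewrite -[X in is_derive _ _ _ X]mulr1.
    exact: (is_deriveZ gamma (is_derive_id _ _)).
  have /cvg_dnbhs_at_right : h^-1 *: ((expR \o *%R gamma) (h *: 1 + 0)
      - (expR \o *%R gamma) 0) @[h --> (0 : R)^'] --> expR (gamma * 0) * gamma.
    have <- := @derive_val _ _ _ _ _ _ _ D.
    exact: (@ex_derive _ _ _ _ _ _ _ D).
  rewrite mulr0 expR0 mul1r; apply: cvg_trans; apply: near_eq_cvg; near=> t.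
  by rewrite /= mulr0 expR0 addr0 /GRing.scale/= mulr1.
apply: cvg_trans; apply: near_eq_cvg; near=> t.
rewrite /rescaled scalerA [expR _ * _]mulrC -!scalerA -scalerDr.
by rewrite scalerBr scalerBl scale1r addrA subrK.
Unshelve. all: by end_near. Qed.

End Rescaling.

(** * The generator, its powers, and averages over short times *)
Section PartialPowers.
Variables (T : Type) (A : partial_op T).

Lemma pdom_exp_le k p g : (k <= p)%N ->
  pdom (partial_exp A p) g -> pdom (partial_exp A k) g.
Proof.
move=> /subnKC <-; elim: (p - k)%N => [|d IH]; first by rewrite addn0.
by rewrite addnS => -[/IH].
Qed.

End PartialPowers.

Section Generator.
Variables (R : realType) (X : completeNormedModType R).
Variables (S : R -> X -> X) (G : partial_op X).
Hypothesis HS : C0_semigroup S.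
Hypothesis S_gen : infinitesimal_generator S (partial_opp G).

(** The sign is there because the infinitesimal generator is [- G]. *)
Lemma generatorP g y : orbit_derivative S g (- y) <-> pdom G g /\ G g = y.
Proof.
split=> [gy|[Dg <-]]; last exact: S_gen.2.
have Dg : pdom G g by apply/(S_gen.1 g)/cvgP/gy.
split=> //; apply: oppr_inj.
exact: (@cvg_unique _ (@norm_hausdorff _ X) _ _ _ _ (S_gen.2 _ Dg) gy).
Qed.

Lemma generator_linear a x y : pdom G x -> pdom G y ->
  pdom G (a *: x + y) /\ G (a *: x + y) = a *: G x + G y.
Proof.
move=> Dx Dy; apply/generatorP.
have : a *: (t^-1 *: (S t x - x)) + t^-1 *: (S t y - y) @[t --> (0 : R)^'+]
    --> a *: (- G x) + (- G y).
  by apply: cvgD; [apply: cvgZl_tmp|]; exact: S_gen.2.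
rewrite opprD -scalerN /orbit_derivative; apply: cvg_trans.
apply: near_eq_cvg; near=> t.
have t0 : 0 <= t by apply/ltW; near: t; exact: nbhs_right_gt.
rewrite (C0_linear HS)// scalerA mulrC -scalerA -scalerDr; congr (_ *: _).
by rewrite scalerBr opprD addrACA.
Unshelve. all: by end_near. Qed.

Lemma generatorB x y : pdom G x -> pdom G y ->
  pdom G (x - y) /\ G (x - y) = G x - G y.
Proof.
move=> Dx Dy; have := generator_linear (-1) Dy Dx.
by rewrite !scaleN1r ![- _ + _]addrC.
Qed.

Lemma generator0 : pdom G 0 /\ G 0 = 0.
Proof.
apply/generatorP; rewrite /orbit_derivative oppr0.
apply: cvg_near_cst; near=> t.
have t0 : 0 <= t by apply/ltW; near: t; exact: nbhs_right_gt.
by have := C0B HS 0 0 t0; rewrite !subrr => ->; rewrite addr0 scaler0.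
Unshelve. all: by end_near. Qed.

Lemma generator_closed (u : nat -> X) x y : (forall n, pdom G (u n)) ->
  u n @[n --> \oo] --> x -> G (u n) @[n --> \oo] --> y -> pdom G x /\ G x = y.
Proof.
move=> Du ux Gy; apply/generatorP.
apply: (orbit_derivative_closed HS (u := u) (v := fun n => - G (u n))) => //.
- by move=> n; exact/generatorP.
- exact: cvgN.
Qed.

Lemma powerB k x y : pdom (partial_exp G k) x -> pdom (partial_exp G k) y ->
  pdom (partial_exp G k) (x - y) /\
  partial_exp G k (x - y) = partial_exp G k x - partial_exp G k y.
Proof.
elim: k => [//|k IH] /= [Dx DGx] [Dy DGy].
have [DB GB] := IH Dx Dy; rewrite GB.
by have [? ->] := generatorB DGx DGy.
Qed.

Lemma power0 k : pdom (partial_exp G k) 0 /\ partial_exp G k 0 = 0.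
Proof.
elim: k => [//|k [D0 G0]] /=; rewrite G0.
by have [? ->] := generator0.
Qed.

(** The mean of the orbit of [g] over the time interval [[0, 2 ^- n]]. *)
Definition average (n : nat) (g : X) : X := 2 ^+ n *: orbit_int S (2 ^- n) g.

Lemma average_cvg g : average n g @[n --> \oo] --> g.
Proof.
have /cvg_at_right0P intg := orbit_int_average HS (g := g).
apply/cvgrPdist_le => e e0; have [d d0 dP] := intg e e0.
have [n nP] := exp2V_small (divr_gt0 d0 (ltr0Sn R 1)).
exists n => // m /= nm; rewrite distrC.
have := dP (2 ^- m); rewrite invrK; apply.
rewrite invr_gt0 exprn_gt0//= (le_lt_trans (nP m nm))//.
by rewrite ltr_pdivrMr// ltr_pMr// ltr1n.
Qed.

Lemma average_continuous n : continuous (average n).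
Proof.
move=> x; apply: cvgZl_tmp; apply: (orbit_int_continuous HS).
exact: exp2V_ge0.
Qed.

Lemma average_generator n g :
  pdom G (average n g) /\ G (average n g) = 2 ^+ n *: (g - S (2 ^- n) g).
Proof.
apply/generatorP; rewrite -scalerN opprB.
set y := orbit_int S (2 ^- n) g.
have : 2 ^+ n *: (t^-1 *: (S t y - y)) @[t --> (0 : R)^'+]
    --> 2 ^+ n *: (S (2 ^- n) g - g).
  by apply: cvgZl_tmp; apply: (orbit_derivative_int HS); exact: exp2V_ge0.
rewrite /orbit_derivative; apply: cvg_trans; apply: near_eq_cvg; near=> t.
have t0 : 0 <= t by apply/ltW; near: t; exact: nbhs_right_gt.
by rewrite /average -/y (C0Z HS)// -scalerBr scalerA mulrC -scalerA.
Unshelve. all: by end_near. Qed.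

Lemma average_commute n g : pdom G g -> G (average n g) = average n (G g).
Proof.
move=> Dg; rewrite (average_generator n g).2; congr (_ *: _).
have /(orbit_int_derivative HS (exp2V_ge0 R n)) :
  orbit_derivative S g (- G g) by exact/generatorP.
rewrite -scaleN1r (orbit_intZ HS) ?exp2V_ge0// scaleN1r => intG.
by apply: oppr_inj; rewrite opprB intG.
Qed.

Lemma average_power n k g : pdom (partial_exp G k) g ->
  pdom (partial_exp G k) (average n g) /\
  partial_exp G k (average n g) = average n (partial_exp G k g).
Proof.
elim: k => [//|k IH] /= [/IH[DA ->] DG].
have [DAG _] := average_generator n (partial_exp G k g).
by split=> //; exact: average_commute.
Qed.

(** An average commutes with [G] and takes its values in the domain of [G], so
    it gains one power of [G]. *)
Lemma average_powerS n k g : pdom (partial_exp G k) g ->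
  pdom (partial_exp G k.+1) (average n g).
Proof.
move=> /(average_power n)[DA GA] /=; split=> //; rewrite GA.
exact: (average_generator n _).1.
Qed.

End Generator.

(** * Generators bounded below on the cone *)
Section PositiveDecay.
Variables (R : realType) (X : orderedBanachType R).
Hypothesis cone_closed : closed (@pos_cone R X).
Hypothesis norm_additive : norm_additive_on_cone X.
Variables (S : R -> X -> X) (G : partial_op X).
Hypothesis HS : C0_semigroup S.
Hypothesis Spos : positive_semigroup S.
Hypothesis S_gen : infinitesimal_generator S (partial_opp G).

Lemma average_pos n g : 0 <=v g -> 0 <=v average S n g.
Proof.
move=> g0; apply: levZ_ge0; first exact: exprn_ge0.
by apply: orbit_int_pos => //; exact: exp2V_ge0.
Qed.

Lemma average_lev n x y : x <=v y -> average S n x <=v average S n y.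
Proof.
move=> /lev_subr0/(average_pos n) xy; apply/lev_subr0.
by rewrite /average -scalerBr -(orbit_intB HS)// exp2V_ge0.
Qed.

Variable gamma : R.
Hypothesis gamma_gt0 : 0 < gamma.
Hypothesis G_ge : forall g, pdom_plus G g -> gamma *: g <=v G g.

(** For [x] in the positive domain the rescaled orbit has derivative
    [- G x + gamma *: x <= 0], so it decreases by [orbit_derivative_le0].  The
    averages of [g] are such elements and converge to [g]; the cone is closed. *)
Lemma positive_decay g t : 0 <=v g -> 0 <= t ->
  S t g <=v expR (- gamma * t) *: g.
Proof.
move=> g0 t0.
apply: (lev_cvg cone_closed (u := fun n => S t (average S n g))
    (v := fun n => expR (- gamma * t) *: average S n g)).
- by apply: continuous_cvg; [exact: (C0_bounded HS)|exact: (average_cvg HS)].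
- by apply: cvgZl_tmp; exact: (average_cvg HS).
move=> n; have [Dg _] := average_generator HS S_gen n g.
set x := average S n g in Dg *; have x0 : 0 <=v x by exact: average_pos.
have Tpos : positive_semigroup (rescaled S gamma).
  by move=> s y s0 y0; apply: levZ_ge0; [exact: expR_ge0|exact: Spos].
have /(generatorP S_gen)/rescaled_derivative xG : pdom G x /\ G x = G x by [].
have := orbit_derivative_le0 cone_closed (rescaled_C0 HS gamma) Tpos t0
  (xG gamma).
rewrite /rescaled => /(_ _)/(levZ2 (expR_ge0 (- gamma * t))).
rewrite [expR _ *: (_ *: _)]scalerA -expRD mulNr addNr expR0 scale1r; apply.
by rewrite addrC -(subrr (G x)); apply: levD2r; exact: G_ge.
Qed.

Lemma positive_decreasing g t : 0 <=v g -> 0 <= t -> S t g <=v g.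
Proof.
move=> g0 t0; apply: lev_trans (positive_decay g0 t0) _.
apply/lev_subr0; rewrite -[X in X - _]scale1r -scalerBl; apply: levZ_ge0 => //.
by rewrite subr_ge0 expR_le1 mulNr oppr_le0 mulr_ge0// ltW.
Qed.

Lemma average_le n g : 0 <=v g -> average S n g <=v g.
Proof.
move=> g0; have h0 := exp2V_ge0 R n.
have := @orbit_int_lev _ _ _ cone_closed HS _ g g h0.
move=> /(_ _)/(levZ2 (exprn_ge0 n (ler0n R 2))).
rewrite scalerA divff ?expf_neq0// scale1r; apply.
by move=> s /andP[s0 _]; exact: positive_decreasing.
Qed.

Lemma average_ge n g : 0 <=v g -> S (2 ^- n) g <=v average S n g.
Proof.
move=> g0; have h0 := exp2V_ge0 R n.
have := @lev_orbit_int _ _ _ cone_closed HS _ (S (2 ^- n) g) g h0.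
move=> /(_ _)/(levZ2 (exprn_ge0 n (ler0n R 2))).
rewrite scalerA divff ?expf_neq0// scale1r; apply.
move=> s /andP[s0 sn]; rewrite -[X in S X _](subrK s) (C0_add HS) ?subr_ge0//.
by apply: positive_decreasing; [exact: Spos|rewrite subr_ge0].
Qed.

(** The shortest interval is averaged over first and the longest last, so that
    the limit in [j] for [n] is a single average of the limit for [n + 1]. *)
Fixpoint iter_average (n j : nat) (g : X) : X :=
  if j is j'.+1 then average S n (iter_average n.+1 j' g) else g.

Lemma iter_average_pos n j g : 0 <=v g -> 0 <=v iter_average n j g.
Proof.
by move=> g0; elim: j n => [//|j IH] n /=; exact/average_pos/IH.
Qed.

Lemma iter_average_decr n j g : 0 <=v g ->
  iter_average n j.+1 g <=v iter_average n j g.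
Proof.
move=> g0; elim: j n => [|j IH] n; first exact: average_le.
by apply: average_lev; exact: IH.
Qed.

Lemma iter_average_le n j g : 0 <=v g -> iter_average n j g <=v g.
Proof.
move=> g0; elim: j => [|j IH]; first exact: lev_refl.
exact: lev_trans (iter_average_decr n j g0) IH.
Qed.

(** An average over [[0, h]] of a decreasing orbit is at least its value at time
    [h], and the lengths [2 ^- n, 2 ^- (n + 1), ...] add up to less than
    [2 ^- n + 2 ^- n]. *)
Lemma iter_average_ge n j g : 0 <=v g ->
  S (2 ^- n + 2 ^- n) g <=v iter_average n j g.
Proof.
move=> g0; have h0 := exp2V_ge0 R; elim: j n => [|j IH] n /=.
  by apply: positive_decreasing => //; rewrite addr_ge0.
apply: lev_trans (average_ge n (iter_average_pos n.+1 j g0)).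
rewrite (C0_add HS)//; apply: C0_lev => //; have := IH n.+1.
suff -> : 2 ^- n.+1 + 2 ^- n.+1 = 2 ^- n :> R by [].
by rewrite [RHS]splitr exprSr invfM.
Qed.

(** The infinite product of averages plays the part of convolution with a smooth
    bump function: it maps the cone into the domain of every power of [G], and its
    existence follows from monotonicity, since each average decreases positive
    elements. *)
Definition smoothing (n : nat) (g : X) : X :=
  lim (iter_average n j g @[j --> \oo]).

Lemma smoothing_cvg n g : 0 <=v g ->
  iter_average n j g @[j --> \oo] --> smoothing n g.
Proof.
move=> g0; apply: (decreasing_pos_cvg norm_additive) => j.
  exact: iter_average_pos.
exact: iter_average_decr.
Qed.

(** This identity carries both the monotonicity in [n], as averages decrease
    positive elements, and the regularity, as each average gains a power of
    [G]. *)
Lemma smoothing_average n g : 0 <=v g ->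
  smoothing n g = average S n (smoothing n.+1 g).
Proof.
move=> g0; apply: (@cvg_unique _ (@norm_hausdorff _ X)
  (iter_average n j.+1 g @[j --> \oo])).
  by have := smoothing_cvg (n := n) g0; rewrite -cvg_shiftS.
by apply: continuous_cvg; [exact: average_continuous|exact: smoothing_cvg].
Qed.

Lemma smoothing_pos n g : 0 <=v g -> 0 <=v smoothing n g.
Proof.
move=> g0; apply: (lev_lim_ge cone_closed (smoothing_cvg (n := n) g0)) => j.
exact: iter_average_pos.
Qed.

Lemma smoothing_le n g : 0 <=v g -> smoothing n g <=v g.
Proof.
move=> g0; apply: (lev_lim_le cone_closed (smoothing_cvg (n := n) g0)) => j.
exact: iter_average_le.
Qed.

Lemma smoothing_ge n g : 0 <=v g -> S (2 ^- n + 2 ^- n) g <=v smoothing n g.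
Proof.
move=> g0.
apply: (lev_lim_ge cone_closed (smoothing_cvg (n := n) g0)) => j.
exact: iter_average_ge.
Qed.

Lemma smoothing_increasing g : 0 <=v g -> increasing (fun n => smoothing n g).
Proof.
move=> g0; apply: increasing_step => n; rewrite smoothing_average//.
by apply: average_le; exact: smoothing_pos.
Qed.

(** Induction on [k] for all [n] at once: peeling off the average of index [n]
    leaves the smoothing of index [n + 1]. *)
Lemma smoothing_power n k g : 0 <=v g -> pdom (partial_exp G k) (smoothing n g).
Proof.
move=> g0; elim: k n => [//|k IH] n; rewrite smoothing_average//.
by apply: average_powerS => //; exact: IH.
Qed.

(** The smoothing lies between [S (2 ^- n + 2 ^- n) g] and [g], and the norm is
    monotone on the cone. *)
Lemma smoothing_to g : 0 <=v g -> increasing_to (fun n => smoothing n g) g.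
Proof.
move=> g0; split; first exact: smoothing_increasing.
apply/cvgrPdist_le => e e0; have [d d0 Sd] := C0_near0 HS g e0.
have [n nP] := exp2V_small (divr_gt0 d0 (ltr0Sn R 1)).
exists n => // m /= nm; have h0 := exp2V_ge0 R m.
have h20 : 0 <= 2 ^- m + 2 ^- m :> R by rewrite addr_ge0.
apply: (le_trans _ (Sd (2 ^- m + 2 ^- m) _)); last first.
  by rewrite h20 [leRHS](splitr d) lerD// nP.
rewrite [leRHS]distrC; apply: lev_norm => //.
  by move/lev_subr0: (smoothing_le m g0).
by rewrite ![g - _]addrC; apply: levD2r; apply: levN2; exact: smoothing_ge.
Qed.

(** On its positive domain [G] dominates [gamma] times the identity, so it maps
    this domain into the cone. *)
Lemma power_pos p k g : (k <= p)%N -> pdom_plus (partial_exp G p) g ->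
  0 <=v partial_exp G k g.
Proof.
move=> kp [Dg g0]; elim: k kp => [//|k IH] kp /=.
have Gk0 : 0 <=v partial_exp G k g by apply: IH; exact: ltnW.
apply: lev_trans (G_ge (conj (pdom_exp_le kp Dg).2 Gk0)).
by apply: levZ_ge0 => //; exact: ltW.
Qed.

(** A bound on the highest power bounds all lower ones, by monotonicity of the
    norm in [gamma *: G^k g <= G^(k+1) g]. *)
Lemma power_norm p k g : (k <= p)%N -> pdom_plus (partial_exp G p) g ->
  gamma ^+ (p - k) * `|partial_exp G k g| <= `|partial_exp G p g|.
Proof.
move=> /subnKC <-; rewrite addKn; elim: (p - k)%N => [|d IH].
  by rewrite addn0 mul1r.
rewrite addnS => -[Dg g0]; have [Dd DGd] := Dg.
have Gd0 := power_pos (leqnn _) (conj Dd g0).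
rewrite exprS -mulrA (le_trans (ler_wpM2l (ltW gamma_gt0) (IH (conj Dd g0))))//.
rewrite -[X in X * _](gtr0_norm gamma_gt0) -normrZ; apply: lev_norm => //.
  by apply: levZ_ge0 => //; exact: ltW.
exact: G_ge.
Qed.

Lemma power_lev p x y : pdom_plus (partial_exp G p) x ->
  pdom_plus (partial_exp G p) y -> x <=v y ->
  forall k, (k <= p)%N -> partial_exp G k x <=v partial_exp G k y.
Proof.
move=> [Dx _] [Dy _] /lev_subr0 xy k kp; apply/lev_subr0.
have [DB _] := powerB HS S_gen Dy Dx.
rewrite -(powerB HS S_gen (pdom_exp_le kp Dy) (pdom_exp_le kp Dx)).2.
exact: power_pos kp (conj DB xy).
Qed.

(** Each sequence [G^k (u n)] with [k <= p] is increasing, positive and bounded,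
    hence convergent; since [G] is closed, the limit for [k + 1] is the image
    under [G] of the limit for [k]. *)
Lemma power_monotone_convergence p (u : nat -> X) (c : R) :
  (forall n, pdom_plus (partial_exp G p) (u n)) -> increasing u ->
  (forall n, `|partial_exp G p (u n)| <= c) ->
  exists g, pdom_plus (partial_exp G p) g /\ forall k, (k <= p)%N ->
    increasing_to (fun n => partial_exp G k (u n)) (partial_exp G k g).
Proof.
move=> Du iu uc.
have inc k : (k <= p)%N -> increasing (fun n => partial_exp G k (u n)).
  by move=> kp n m nm; apply: (power_lev (p := p)) => //; exact: iu.
have cv k : (k <= p)%N -> cvg (partial_exp G k (u n) @[n --> \oo]).
  move=> kp; apply: (increasing_bounded_cvg norm_additive
    (c := c / gamma ^+ (p - k))) => [n| |n].
  - exact: power_pos kp (Du n).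
  - exact: inc.
  - rewrite ler_pdivlMr ?exprn_gt0// mulrC (le_trans (power_norm kp (Du n)))//.
pose y k := lim (partial_exp G k (u n) @[n --> \oo]).
have yP k : (k <= p)%N ->
    pdom (partial_exp G k) (y 0) /\ partial_exp G k (y 0) = y k.
  elim: k => [//|k IH] kp; have [Dk Gk] := IH (ltnW kp).
  rewrite /=; have [] := @generator_closed _ _ _ _ HS S_gen
    (fun n => partial_exp G k (u n)) (y k) (y k.+1).
  - by move=> n; have [] := pdom_exp_le kp (Du n).1.
  - exact: cv (ltnW kp).
  - exact: cv kp.
  by rewrite Gk.
exists (y 0); split.
  split; first by have [] := yP p (leqnn p).
  apply: (lev_lim_ge cone_closed (cv 0 (leq0n p))) => n.
  exact: power_pos (leq0n p) (Du n).
move=> k kp; split; first exact: inc.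
by rewrite (yP k kp).2; exact: cv.
Qed.

(** The smoothings [g_n] of [g] increase to [g] below [h], so [G^p g_n] lies
    between 0 and [G^p h] and is norm bounded; monotone convergence puts their
    limit in the domain of [G^p]. *)
Lemma power_saturated p g h : pdom_plus (partial_exp G p) h -> 0 <=v g ->
  g <=v h -> pdom_plus (partial_exp G p) g.
Proof.
move=> Dh g0 gh.
have Du n : pdom_plus (partial_exp G p) (smoothing n g).
  by split; [exact: smoothing_power|exact: smoothing_pos].
have [|n|y [Dy /(_ 0 (leq0n p))[_ uy]]] := @power_monotone_convergence p
    (fun n => smoothing n g) `|partial_exp G p h| Du.
- exact: smoothing_increasing.
- apply: lev_norm => //; first exact: power_pos (leqnn p) (Du n).
  apply: (power_lev (Du n) Dh) => //; apply: lev_trans gh; exact: smoothing_le.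
suff -> : g = y by [].
exact: (cvg_unique (@norm_hausdorff _ X) (smoothing_to g0).2 uy).
Qed.

End PositiveDecay.

(** * The four properties *)

Theorem lemma1 (R : realType) (X : orderedBanachType R)
    (X_separable : separable X)
    (cone_closed : closed (@pos_cone R X))
    (cone_generating : generating_cone X)
    (norm_additive : norm_additive_on_cone X)
    (S : R -> X -> X) (G : partial_op X)
    (S_C0 : C0_semigroup S)
    (S_pos : positive_semigroup S)
    (S_gen : infinitesimal_generator S (partial_opp G))
    (gamma : R) (gamma_gt0 : 0 < gamma)
    (G_ge : forall g, pdom_plus G g -> gamma *: g <=v G g) :
  (forall g, pos_cone g -> forall t : R, 0 <= t ->
     0 <=v S t g /\ S t g <=v expR (- gamma * t) *: g) /\
  (forall g, pos_cone g ->
     exists g_ : nat -> X,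
       (forall n, pdom_plus_infty G (g_ n)) /\ increasing_to g_ g) /\
  (forall (p : nat) (g_ : nat -> X),
     (0 < p)%N ->
     (forall n, pdom_plus (partial_exp G p) (g_ n)) ->
     increasing g_ ->
     bounded_fun (fun n => partial_exp G p (g_ n)) ->
     exists g, pdom_plus (partial_exp G p) g /\
       forall k, (k <= p)%N ->
         increasing_to (fun n => partial_exp G k (g_ n)) (partial_exp G k g)) /\
  ((forall k, (1 <= k)%N -> p_saturated (pdom_plus (partial_exp G k))) /\
   p_saturated (pdom_plus_infty G)).
Proof.
have decay := positive_decay cone_closed S_C0 S_pos S_gen G_ge.
have in_domain :=
  smoothing_power cone_closed norm_additive S_C0 S_pos S_gen gamma_gt0 G_ge.
have pos :=
  smoothing_pos cone_closed norm_additive S_C0 S_pos S_gen gamma_gt0 G_ge.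
have approx :=
  smoothing_to cone_closed norm_additive S_C0 S_pos S_gen gamma_gt0 G_ge.
split=> [g g0 t t0|]; first by split; [exact: S_pos|exact: decay].
split=> [g g0|].
  exists (fun n => smoothing S n g); split; last exact: approx.
  by move=> n k _; split; [exact: in_domain|exact: pos].
split=> [p u _ Du iu [M [_ uM]]|].
  apply: (power_monotone_convergence cone_closed norm_additive S_C0 S_gen
    gamma_gt0 G_ge Du iu (c := M + 1)) => n.
  by apply: uM => //; rewrite ltrDl.
have D0 k : pdom_plus (partial_exp G k) 0.
  by split; [exact: (power0 S_C0 S_gen k).1|exact: lev_refl].
have sat := power_saturated cone_closed norm_additive S_C0 S_pos S_gen
  gamma_gt0 G_ge.
split=> [k _|].
  by split=> [|g h Dh g0 gh]; [exists 0|exact: sat Dh g0 gh].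
split=> [|g h Dh g0 gh k k1]; first by exists 0 => k _.
exact: sat (Dh k k1) g0 gh.
Qed.
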